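(* Let $M$ be a compact topological manifold with $\dim(M)\ge2$ and let $f\in Hom(M)$ admit a continuous strict Lyapunov function. If there exists a decomposition of $\mathcal{GR}(f)$ without cycles, then there exists a neighborhood $V$ of $f$ in $Hom(M)$ such that any $g\in V$ admits a continuous strict Lyapunov function.
   Context: Fix a metric $d$ on $M$ compatible with its topology. $Hom(M)$ is the space of homeomorphisms of $M$ with the uniform topology induced by $d_{\mathscr{C}^0}(f,g)=\max_{x\in M}d(f(x),g(x))$. A continuous function $u:M\to\mathbb{R}$ is a Lyapunov function for $f$ if $u(f(x))\le u(x)$ for every $x\in M$; it is strict if it is not a first integral, i.e. there exists $x\in M$ with $u(f(x))<u(x)$. A strong $\varepsilon$-chain for $f$ from $x$ to $y$ (for a metric $d$) is a finite sequence $(x_i)_{i=1}^n$ ($n\ge1$) in $M$ with $x_1=x$ and, setting $x_{n+1}=y$, $\sum_{i=1}^n d(f(x_i),x_{i+1})<\varepsilon$. $\mathcal{SCR}_d(f)$ is the set of $x\in M$ such that for every $\varepsilon>0$ there is a strong $\varepsilon$-chain from $x$ to $x$. The generalized recurrent set is $\mathcal{GR}(f)=\bigcap_{d'}\mathcal{SCR}_{d'}(f)$, the intersection being over all metrics $d'$ compatible with the topology of $M$. For a compact invariant set $L\subseteq M$, $W^s(L)=\{x\in M: d(f^k(x),L)\to0 \text{ as } k\to+\infty\}$ and $W^u(L)=\{x\in M: d(f^{-k}(x),L)\to0 \text{ as } k\to+\infty\}$. A decomposition of $\mathcal{GR}(f)$ is a finite family $L_1,\dots,L_k$ of compact, invariant,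 pairwise disjoint subsets with $\mathcal{GR}(f)=\bigcup_{i=1}^kL_i$. For $i,j\in\{1,\dots,k\}$ (possibly equal) write $L_i\rightharpoonup L_j$ if $(W^u(L_i)\cap W^s(L_j))\setminus\mathcal{GR}(f)\neq\emptyset$. The sets $L_{i_1},\dots,L_{i_r}$ form an $r\ge1$ cycle if $L_{i_1}\rightharpoonup L_{i_2}\rightharpoonup\cdots\rightharpoonup L_{i_r}\rightharpoonup L_{i_1}$. The decomposition is without cycles if no subset of $\{L_i\}$ forms an $r\ge1$ cycle. *)

(* Defs.v *)
From HB Require Import structures.
From mathcomp Require Import all_boot all_order all_algebra.
From mathcomp Require Import all_classical all_reals all_analysis.

Set Implicit Arguments.
Unset Strict Implicit.
Unset Printing Implicit Defensive.

Import Order.TTheory GRing.Theory Num.Theory.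
Import numFieldNormedType.Exports.

Local Open Scope classical_set_scope.
Local Open Scope ring_scope.

(* A chart around [x]: [phi] maps the open set [U] homeomorphically, with
   inverse [psi], onto the open subset [phi @` U] of R^n. *)
Definition locally_euclidean (R : realType) (n : nat) (M : topologicalType) :=
  forall x : M, exists U : set M, exists phi : M -> 'rV[R]_n,
  exists psi : 'rV[R]_n -> M,
    [/\ open U /\ U x, open (phi @` U), {within U, continuous phi},
        {within phi @` U, continuous psi} & {in U, cancel phi psi}].

Definition topological_manifold (R : realType) (n : nat)
    (M : topologicalType) :=
  [/\ hausdorff_space M, @second_countable M & locally_euclidean R n M].

Record homeo (M : topologicalType) := Homeo {
  homeo_fun :> M -> M;
  homeo_inv : M -> M;
  homeo_funK : cancel homeo_fun homeo_inv;
  homeo_invK : cancel homeo_inv homeo_fun;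
  homeo_fun_continuous : continuous homeo_fun;
  homeo_inv_continuous : continuous homeo_inv }.

(* The supremum is a maximum when [M] is compact and nonempty. *)
Definition dC0 (R : realType) (M : metricType R) (f g : homeo M) : R :=
  sup [set mdist (f x) (g x) | x in [set: M]].

Definition homeo_nbhs (R : realType) (M : metricType R) (f : homeo M)
    (V : set (homeo M)) :=
  exists2 e : R, 0 < e & [set g | dC0 f g < e] `<=` V.

Definition lyapunov (R : realType) (M : topologicalType) (f : M -> M)
    (u : M -> R) :=
  continuous u /\ forall x, u (f x) <= u x.

Definition strict_lyapunov (R : realType) (M : topologicalType) (f : M -> M)
    (u : M -> R) :=
  lyapunov f u /\ exists x, u (f x) < u x.

Definition is_metric (R : realType) (M : Type) (d : M -> M -> R) :=
  [/\ forall x y, 0 <= d x y,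
      forall x y, d x y = 0 <-> x = y,
      forall x y, d x y = d y x &
      forall x y z, d x z <= d x y + d y z].

Definition compatible_metric (R : realType) (M : topologicalType)
    (d : M -> M -> R) :=
  is_metric d /\
  forall (x : M) (A : set M),
    nbhs x A <-> exists2 e : R, 0 < e & [set y | d x y < e] `<=` A.

(* Indices are shifted by one: [c i] is the point x_(i+1) of the chain, and
   [c n] is its endpoint x_(n+1) = y. *)
Definition strong_chain (R : realType) (M : Type) (d : M -> M -> R)
    (f : M -> M) (e : R) (x y : M) :=
  exists n : nat, exists c : nat -> M,
    [/\ (1 <= n)%N, c 0%N = x, c n = y &
        \sum_(i < n) d (f (c i)) (c i.+1) < e].

Definition strong_chain_recurrent (R : realType) (M : Type)
    (d : M -> M -> R) (f : M -> M) : set M :=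
  [set x | forall e : R, 0 < e -> strong_chain d f e x x].

Definition generalized_recurrent (R : realType) (M : topologicalType)
    (f : M -> M) : set M :=
  \bigcap_(d in [set d : M -> M -> R | compatible_metric d])
    strong_chain_recurrent d f.

(* Extended-real valued, so that the distance to the empty set is [+oo]. *)
Definition set_dist (R : realType) (M : metricType R) (x : M) (L : set M) :
    \bar R :=
  ereal_inf [set (mdist x a)%:E | a in L].

Definition stable_set (R : realType) (M : metricType R) (f : homeo M)
    (L : set M) : set M :=
  [set x | set_dist (iter k f x) L @[k --> \oo] --> 0%E].

Definition unstable_set (R : realType) (M : metricType R) (f : homeo M)
    (L : set M) : set M :=
  [set x | set_dist (iter k (homeo_inv f) x) L @[k --> \oo] --> 0%E].

Definition decomposition (R : realType) (M : metricType R) (f : homeo M)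
    (k : nat) (L : 'I_k -> set M) :=
  [/\ forall i, compact (L i),
      forall i, f @` L i = L i,
      trivIset setT L &
      generalized_recurrent R f = \bigcup_i L i].

Definition connects (R : realType) (M : metricType R) (f : homeo M)
    (A B : set M) :=
  (unstable_set f A `&` stable_set f B) `\` generalized_recurrent R f !=set0.

(* [cycle e c] holds for the empty sequence, which is not an r-cycle with
   r >= 1. *)
Definition without_cycles (R : realType) (M : metricType R) (f : homeo M)
    (k : nat) (L : 'I_k -> set M) :=
  forall c : seq 'I_k, c != [::] ->
    ~~ cycle (fun i j => `[< connects f (L i) (L j) >]) c.

(* Main.v *)
(* A point [x] where a Lyapunov function of [f] decreases is not in GR(f). It is
   not chain recurrent either: otherwise let [K] be its chain transitive
   component. Limit sets are nonwandering, hence in GR(f), and by invariance each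
   one lies in a single [L i]. If [L i] meets [K], small chains from [L i] to [x]
   must leave a neighbourhood of [L i], and their exit points accumulate at a
   point of [K] outside GR(f) lying in the unstable set of [L i]; its forward
   orbit converges to some [L j] meeting [K]. Finiteness produces a cycle.
   So for some [e] there is no [e]-chain from [x] to [x] for [f], nor, when [g]
   is [e / 2]-close to [f], any [e / 2]-chain for [g]. The set [U] reached from
   [x] by [e / 2]-chains for [g] then satisfies [g (closure U)] inside [U], and a
   Urysohn function of this trapping region is a strict Lyapunov function. *)

Require Import Defs.
From HB Require Import structures.
From mathcomp Require Import all_boot all_order all_algebra.
From mathcomp Require Import all_classical all_reals all_analysis.
From mathcomp Require Import lra.

Set Implicit Arguments.
Unset Strict Implicit.
Unset Printing Implicit Defensive.

Import Order.TTheory GRing.Theory Num.Theory.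
Import numFieldNormedType.Exports.

Local Open Scope classical_set_scope.
Local Open Scope ring_scope.

(** * Limit sets of orbits in a compact metric space *)

Lemma nbhs_mdistP (R : realType) (M : metricType R) (x : M) (A : set M) :
  nbhs x A <-> exists2 e : R, 0 < e & forall y, mdist x y < e -> A y.
Proof.
split=> [/nbhs_ballP[e /= e0]|[e e0 xA]].
  by rewrite ballEmdist => xA; exists e.
by apply/nbhs_ballP; exists e => //; rewrite ballEmdist.
Qed.

Lemma continuous_mdist (R : realType) (M : metricType R) (f : M -> M) (x : M)
    (e : R) : {for x, continuous f} -> 0 < e ->
  exists2 d : R, 0 < d & forall y, mdist x y < d -> mdist (f x) (f y) < e.
Proof.
move=> fx e0; have /fx/nbhs_mdistP[d d0 dP] : nbhs (f x) [set y | mdist (f x) y < e].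
  by apply/nbhs_mdistP; exists e.
by exists d.
Qed.

(** Compactness in covering form: a point outside [W] is not a cluster point, so one of its
    neighbourhoods misses a member of [F]; a point of [W] has [W] itself as neighbourhood. *)
Lemma cluster_sub_near (T : topologicalType) (F : set_system T) (W : set T) :
  compact [set: T] -> Filter F -> open W -> cluster F `<=` W -> F W.
Proof.
move=> /compact_near_coveringP cT FF oW FW.
have : forall x, [set: T] x -> \forall x' \near x & i \near F, x' = i -> W i.
  move=> x _; have [Wx|nWx] := pselect (W x).
    exists (W, setT) => /=; first by split; [exact: open_nbhs_nbhs|exact: filterT].
    by move=> [a b] /= [Wa _] <-.
  have /existsNP[A /existsNP[B /not_implyP[FA /not_implyP[xB AB]]]] :
    ~ cluster F x by move=> /FW.
  exists (B, A) => //= -[a b] /= [Ba Ab] ab.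
  by exfalso; apply: AB; exists b; split => //; rewrite -ab.
move=> /(cT _ F (fun i x => x = i -> W i) FF); apply: filterS => i /(_ i I).
exact.
Qed.

Lemma cluster_seqP (T : topologicalType) (u : nat -> T) (p : T) :
  cluster (u k @[k --> \oo]) p <->
  forall (A : set T) (N : nat), nbhs p A -> exists2 k, (N <= k)%N & A (u k).
Proof.
split=> [up A N pA|uP A B [N _ uA] /(uP _ N)[k Nk Bk]].
  have [|_ [[k /= Nk <-] Ak]] := up (u @` [set k | (N <= k)%N]) A _ pA.
    by exists N => // k /= Nk; exists k.
  by exists k.
by exists (u k); split => //; exact: uA.
Qed.

(** Separate [A] and [B] by disjoint open sets [U] and [V]. Eventually each orbit point lies in the
    same one of them as its successor, so after a visit to [U] near [p] the orbit never reaches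
    [V]. *)
Lemma orbit_limit (R : realType) (M : metricType R) (h : M -> M) (x : M)
    (A B : set M) :
  compact [set: M] -> continuous h -> closed A -> closed B ->
  A `&` B = set0 -> h @` A `<=` A -> h @` B `<=` B ->
  cluster (iter k h x @[k --> \oo]) `<=` A `|` B ->
  cluster (iter k h x @[k --> \oo]) `&` A !=set0 ->
  cluster (iter k h x @[k --> \oo]) `<=` A.
Proof.
move=> cM ch cA cB AB0 hA hB xAB [p [xp Ap]].
have [U [V [oU oV AU BV UV0]]] :=
  (@normal_openP R M).1 pseudometric_normal A B cA cB AB0.
have oI W : open W -> open (W `&` h @^-1` W).
  by move=> oW; apply: openI => //; apply: open_comp => // z _; exact: ch.
have := @cluster_sub_near _ (iter k h x @[k --> \oo])
  ((U `&` h @^-1` U) `|` (V `&` h @^-1` V)) cM _.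
case=> [|q /xAB[Aq|Bq]|N _ xN].
- by apply: openU; exact: oI.
- by left; split; apply: AU => //; apply: hA; exists q.
- by right; split; apply: BV => //; apply: hB; exists q.
have Up : nbhs p (U `&` h @^-1` U).
  apply: open_nbhs_nbhs; split; first exact: oI.
  by split; apply: AU => //; apply: hA; exists p.
have [k Nk Uk] := (cluster_seqP _ _).1 xp _ N Up.
have U_ge m : (k <= m)%N -> (U `&` h @^-1` U) (iter m h x).
  elim: m => [|m IH]; first by rewrite leqn0 => /eqP <-.
  rewrite leq_eqVlt => /orP[/eqP <- //|km].
  have [_ Um1] := IH km.
  have [//|[Vm1 _]] : ((U `&` h @^-1` U) `|` (V `&` h @^-1` V)) (iter m.+1 h x).
    by apply: xN => /=; rewrite (leq_trans Nk)// ltnW.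
  by suff : set0 (iter m.+1 h x) by []; rewrite -UV0.
move=> q /[dup] xq /xAB[//|Bq].
have Vq : nbhs q V by apply: open_nbhs_nbhs; split=> //; exact: BV.
have [m km Vm] := (cluster_seqP _ _).1 xq _ k Vq.
by suff : set0 (iter m h x) by []; rewrite -UV0; split=> //; case: (U_ge _ km).
Qed.

Lemma set_dist_cvg0 (R : realType) (M : metricType R) (u : nat -> M)
    (A : set M) : compact [set: M] ->
  cluster (u k @[k --> \oo]) `<=` A -> set_dist (u k) A @[k --> \oo] --> 0%E.
Proof.
move=> cM uA; apply/fine_cvgP.
have near_lt (e : R) : 0 < e -> \forall k \near \oo, (set_dist (u k) A < e%:E)%E.
  move=> e0; have := @cluster_sub_near _ (u k @[k --> \oo])
    (\bigcup_(a in A) (ball a e)°) cM _.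
  case.
  - by apply: bigcup_open => a _; exact: open_interior.
  - by move=> a /uA Aa; exists a => //; exact: nbhsx_ballx.
  - move=> N _ NP; exists N => // k /NP [a Aa /interior_subset].
    rewrite ballEmdist /= => ae; apply: (@le_lt_trans _ _ (mdist (u k) a)%:E).
      by apply: ereal_inf_lbound; exists a.
    by rewrite lte_fin metric_sym.
have ge0 k : (0 <= set_dist (u k) A)%E.
  by apply: le_ereal_inf_tmp => _ [a _ <-]; rewrite lee_fin mdist_ge0.
have fin k (e : R) : (set_dist (u k) A < e%:E)%E -> set_dist (u k) A \is a fin_num.
  by move=> lte; rewrite ge0_fin_numE// (lt_trans lte)// ltry.
(* Convergence in the extended reals also requires the distance to be eventually finite; being below
   1 ensures this. *)
split; first by apply: filterS (near_lt 1 ltr01) => k; exact: fin.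
apply/cvgrPdist_lt => e e0; apply: filterS (near_lt e e0) => k ke.
rewrite sub0r normrN ger0_norm ?fine_ge0//.
by rewrite -lte_fin fineK//; exact: fin ke.
Qed.

(** * Chains with small jumps *)

(** Each jump is bounded, not the sum of jumps as in [strong_chain], so that a uniform perturbation
    of [f] costs the same amount at every step whatever the length. At least one jump is made, so a
    chain from [x] to [x] is never trivial. *)
Inductive eps_chain (R : realType) (M : metricType R) (f : M -> M) (e : R) :
    M -> M -> Prop :=
| eps_chain_step x y : mdist (f x) y < e -> eps_chain f e x y
| eps_chain_cons x y z :
    mdist (f x) y < e -> eps_chain f e y z -> eps_chain f e x z.

Lemma eps_chain_sub (R : realType) (M : metricType R) (f g : M -> M)
    (d e : R) (x y : M) :
  (forall x y, mdist (f x) y < d -> mdist (g x) y < e) ->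
  eps_chain f d x y -> eps_chain g e x y.
Proof.
move=> fg; elim=> {x y} [x y /fg|x y z /fg xy _ yz]; first exact: eps_chain_step.
exact: eps_chain_cons yz.
Qed.

Lemma eps_chain_le (R : realType) (M : metricType R) (f : M -> M)
    (d e : R) (x y : M) : d <= e -> eps_chain f d x y -> eps_chain f e x y.
Proof. by move=> de; apply: eps_chain_sub => ? ? /lt_le_trans; apply. Qed.

Lemma eps_chain_trans (R : realType) (M : metricType R) (f : M -> M)
    (e : R) (x y z : M) :
  eps_chain f e x y -> eps_chain f e y z -> eps_chain f e x z.
Proof.
by elim=> {x y} [x y xy yz|x y w xy _ IH /IH wz]; apply: eps_chain_cons xy _.
Qed.

Lemma eps_chain_last (R : realType) (M : metricType R) (f : M -> M)
    (d e : R) (x y y' : M) :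
  eps_chain f d x y -> mdist y y' < e -> eps_chain f (d + e) x y'.
Proof.
move=> xy yy'; elim: xy yy' => {x y} [x y xy yy'|x y z xy _ IH /[dup] /IH yz zy'].
  by apply: eps_chain_step; rewrite (le_lt_trans (metric_triangle _ y _)) ?ltrD.
apply: eps_chain_cons yz; rewrite (lt_le_trans xy)// lerDl.
exact: le_trans (mdist_ge0 _ _) (ltW zy').
Qed.

(** The initial point enters a chain only through its image, so it is the images that must be
    close. *)
Lemma eps_chain_head (R : realType) (M : metricType R) (f : M -> M)
    (d e : R) (x x' y : M) :
  eps_chain f d x y -> mdist (f x') (f x) < e -> eps_chain f (d + e) x' y.
Proof.
have lt a b : mdist (f a) b < d -> mdist (f x') (f a) < e ->
    mdist (f x') b < d + e.
  by move=> ab x'a; rewrite (le_lt_trans (metric_triangle _ (f a) _)) ?[d + e]addrC ?ltrD.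
move=> xy; case: xy => {x y} [x y xy x'x|x y z xy yz x'x].
  exact/eps_chain_step/(lt _ _ xy).
apply: eps_chain_cons (lt _ _ xy x'x) _; apply: eps_chain_le yz.
by rewrite lerDl (le_trans (mdist_ge0 _ _) (ltW x'x)).
Qed.

(** * Extraction by compactness and by finiteness *)

Lemma approx_cluster (R : realType) (M : metricType R) (P : R -> set M) :
  compact [set: M] -> (forall d e, d <= e -> P d `<=` P e) ->
  (forall e, 0 < e -> P e !=set0) ->
  exists y, forall e, 0 < e -> exists2 y', mdist y y' < e & P e y'.
Proof.
move=> cM Ple P0; pose F := filter_from [set e : R | 0 < e] P.
have FF : ProperFilter F.
  apply: filter_from_proper; last exact: P0.
  apply: filter_from_filter; first by exists 1 => /=.
  move=> d e /= d0 e0; exists (Num.min d e) => /=; first by rewrite lt_min d0.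
  by move=> y Py; split; apply: Ple Py; rewrite ge_min lexx ?orbT.
have [y [_ Fy]] := cM F FF filterT.
exists y => e e0; have [||y' [Py' yy']] := Fy (P e) [set y' | mdist y y' < e].
- by exists e.
- by apply/nbhs_mdistP; exists e.
- by exists y'.
Qed.

(** The orbit of [x] under a choice [s] of successors revisits a point, as [T] is finite; the loop
    is the cycle. *)
Lemma cycle_of_successors (T : finType) (P : pred T) (r : rel T) (x : T) :
  P x -> (forall y, P y -> exists2 z, P z & r y z) ->
  exists2 c : seq T, c != [::] & cycle r c.
Proof.
move=> Px succ.
have /choice[s sP] : forall y, exists z, P y -> P z /\ r y z.
  move=> y; have [/succ[z Pz yz]|nPy] := pselect (P y); first by exists z.
  by exists y => /nPy.
have Ps m : P (iter m s x) by elim: m => //= m /sP[].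
have := looping_order s x; rewrite /looping => /trajectP[m mo xm].
have rp p m' : path r (iter m' s x) (traject s (iter m'.+1 s x) p).
  elim: p m' => [|p IH] m' //=.
  by rewrite -iterS IH andbT; have [] := sP _ (Ps m').
pose p := (fingraph.order s x - m.+1)%N.
exists (traject s (iter m s x) p.+1) => //=.
have -> : rcons (traject s (s (iter m s x)) p) (iter m s x) =
    traject s (s (iter m s x)) p.+1.
  rewrite trajectSr; congr rcons; rewrite -iterS -iterD -xm; congr (iter _ s x).
  by rewrite /p addnC addnBA// addnC addnK.
exact: rp.
Qed.

(** * Generalized recurrent points *)

(** For any compatible [d], jump from [f p] to [f w], follow the true orbit of [w], and jump back to
    [p] on its return: only the first and last jumps cost anything. *)
Lemma nonwandering_generalized_recurrent (R : realType) (M : metricType R)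
    (f : M -> M) (p : M) : continuous f ->
  (forall U, nbhs p U -> exists w k, U w /\ U (iter k.+1 f w)) ->
  generalized_recurrent R f p.
Proof.
move=> cf pP d /= [[d0 dE dC dT] dN] e e0.
have e20 : 0 < e / 2 by rewrite divr_gt0.
have nE q : nbhs q [set y | d q y < e / 2] by apply/dN; exists (e / 2).
have [w [k [[_ fw] [kw _]]]] := pP _ (filterI (nE p) (cf p _ (nE (f p)))).
(* If [w] returns after one iterate, both jumps merge into the single jump from [f p] to [p]. *)
case: k kw => [|k] kw.
  exists 1%N, (fun _ => p); split => //; rewrite big_ord1.
  apply: le_lt_trans (dT _ (f w) _) _.
  by rewrite (splitr e) ltrD// dC.
exists k.+2, (fun i => if (i == 0)%N || (i == k.+2)%N then p else iter i f w).
split; rewrite ?eqxx ?orbT// big_ord_recl big_ord_recr /=.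
rewrite big1 ?add0r => [|i _].
  by rewrite !eqxx/= (ltn_eqF (ltnSn _)) (splitr e) ltrD// dC.
have ik : (i < k)%N by [].
rewrite /bump /= !add1n !eqSS !(ltn_eqF _)//; last by rewrite ltnS ltnW.
exact/dE.
Qed.

Lemma orbit_cluster_generalized_recurrent (R : realType) (M : metricType R)
    (f : homeo M) (x p : M) :
  cluster (iter k f x @[k --> \oo]) p -> generalized_recurrent R f p.
Proof.
move=> /cluster_seqP xp; apply: nonwandering_generalized_recurrent => [|U Up].
  exact: homeo_fun_continuous.
have [k _ Uk] := xp U 0%N Up; have [l kl Ul] := xp U k.+1 Up.
exists (iter k f x), (l - k.+1)%N; split => //.
by rewrite -iterD -subSn// subSS subnK// ltnW.
Qed.

Lemma backward_orbit_cluster_generalized_recurrent (R : realType)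
    (M : metricType R) (f : homeo M) (x p : M) :
  cluster (iter k (homeo_inv f) x @[k --> \oo]) p ->
  generalized_recurrent R f p.
Proof.
move=> /cluster_seqP xp; apply: nonwandering_generalized_recurrent => [|U Up].
  exact: homeo_fun_continuous.
have [k _ Uk] := xp U 0%N Up; have [l kl Ul] := xp U k.+1 Up.
exists (iter l (homeo_inv f) x), (l - k.+1)%N; split => //.
rewrite -subSn// subSS; set m := (l - k)%N.
have -> : l = (m + k)%N by rewrite /m subnK// ltnW.
rewrite iterD; elim: m => //= m IH.
by rewrite -iterS iterSr homeo_invK.
Qed.

Lemma strict_lyapunov_not_generalized_recurrent (R : realType)
    (M : metricType R) (f : M -> M) (u : M -> R) (x : M) :
  lyapunov f u -> u (f x) < u x -> ~ generalized_recurrent R f x.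
Proof.
move=> [cu fu] ux.
(* [u] is 1-Lipschitz for the compatible metric [d], so along a [d]-strong chain
   its total increase at the jumps is small. *)
pose d (y z : M) := mdist y z + `|u y - u z|.
have dP : compatible_metric d.
  split; first split.
  - by move=> y z; rewrite addr_ge0 ?mdist_ge0.
  - move=> y z; split=> [/eqP|->]; last by rewrite /d mdistxx subrr normr0 addr0.
    rewrite paddr_eq0 ?mdist_ge0// => /andP[/eqP + _].
    exact: mdist_positivity.
  - by move=> y z; rewrite /d metric_sym distrC.
  - move=> y z t; rewrite /d addrACA lerD ?metric_triangle//.
    by rewrite (le_trans _ (ler_normD _ _))// addrA subrK.
  move=> y A; split=> [/nbhs_mdistP[e e0 eA]|[e e0 eA]].
    exists e => // z /= yz; apply: eA; apply: le_lt_trans yz.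
    by rewrite lerDl.
  have e20 : 0 < e / 2 by rewrite divr_gt0.
  have := cu y; move=> /cvgrPdist_lt/(_ _ e20).
  have : nbhs y [set z | mdist y z < e / 2] by apply/nbhs_mdistP; exists (e / 2).
  apply: filterS2 => z yz uyz; apply: eA => /=.
  by rewrite (splitr e) ltrD.
move=> /(_ d dP) /(_ (u x - u (f x))); rewrite subr_gt0 => /(_ ux).
move=> [n [c [n1 c0 cn]]]; rewrite ltNge => /negP; apply.
apply: (@le_trans _ _ (\sum_(i < n) (u (c i.+1) - u (f (c i))))); last first.
  apply: ler_sum => i _; rewrite (le_trans (ler_norm _))// distrC lerDr.
  exact: mdist_ge0.
have /eqP : \sum_(i < n) (u (c i.+1) - u (c i)) = 0.
  rewrite -(big_mkord xpredT (fun i => u (c i.+1) - u (c i))).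
  by rewrite telescope_sumr// c0 cn subrr.
case: n n1 c0 cn => // n _ c0 cn.
(* The strict decrease at [x] is charged to the first term; the other terms only use that [u] does
   not increase along [f]. *)
rewrite !big_ord_recl c0 /= => /eqP s0.
have : \sum_(i < n) (u (c (bump 0 i).+1) - u (c (bump 0 i))) <=
    \sum_(i < n) (u (c (bump 0 i).+1) - u (f (c (bump 0 i)))).
  by apply: ler_sum => i _; rewrite lerD2l lerN2.
by lra.
Qed.

(** * Backward chains *)

(** For a fixed number [j] of steps, continuity of the inverse keeps a backward chain with small
    jumps close to the true backward orbit of [z]. *)
Lemma backward_shadowing (R : realType) (M : metricType R) (f : homeo M)
    (j : nat) (z : M) (W : set M) :
  nbhs (iter j (homeo_inv f) z) W ->
  exists2 d : R, 0 < d &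
    forall b : nat -> M, (forall i, mdist (f (b i.+1)) (b i) < d) ->
      mdist z (b 0%N) < d -> W (b j).
Proof.
elim: j z => [|j IH] z.
  by move=> /nbhs_mdistP[d d0 dW]; exists d => // b _; exact: dW.
rewrite iterSr => /IH[d d0 dW].
have [e e0 eP] := continuous_mdist (@homeo_inv_continuous _ f z) d0.
have e20 : 0 < e / 2 by rewrite divr_gt0.
exists (Num.min d (e / 2)) => [|b bP]; first by rewrite lt_min d0.
rewrite lt_min => /andP[_ zb].
apply: (dW (fun i => b i.+1)) => [i|].
  by apply: lt_le_trans (bP _) _; rewrite ge_min lexx.
rewrite -[b 1%N](homeo_funK f); apply: eP.
apply: le_lt_trans (metric_triangle _ (b 0%N) _) _.
rewrite (splitr e) ltrD// metric_sym; apply: lt_le_trans (bP _) _.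
by rewrite ge_min lexx orbT.
Qed.

(* [b] runs along the chain backwards from its first point outside [O], and then
   along the given infinite backward chain ending at [z]. *)
Lemma eps_chain_exit (R : realType) (M : metricType R) (f : M -> M)
    (O : set M) (e : R) (x z : M) :
  ~ O x -> eps_chain f e x x -> eps_chain f e z x -> eps_chain f e x z ->
  (exists2 b : nat -> M, b 0%N = z &
     forall i, mdist (f (b i.+1)) (b i) < e /\ O (b i)) ->
  exists b : nat -> M,
    [/\ ~ O (b 0%N), forall i, mdist (f (b i.+1)) (b i) < e /\ O (b i.+1),
        eps_chain f e x (b 0%N) & eps_chain f e (b 0%N) x].
Proof.
move=> + + zx; elim: zx => {z x} [z x zx nOx xx xz|z y x zy yx IH nOx xx xz].
  move=> [b b0 bP]; exists (fun i => if i is i'.+1 then b i' else x).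
  split=> // -[|i]; last by split; [exact: (bP i).1|exact: (bP i.+1).2].
  by rewrite b0; split=> //; rewrite -b0; exact: (bP 0%N).2.
move=> [b b0 bP]; pose b' i := if i is i'.+1 then b i' else y.
have xy : eps_chain f e x y by apply: eps_chain_trans xz (eps_chain_step zy).
have b'P i : mdist (f (b' i.+1)) (b' i) < e.
  by case: i => [|i] /=; [rewrite b0|exact: (bP i).1].
have [Oy|nOy] := pselect (O y); last first.
  by exists b'; split=> // i; split=> //; exact: (bP i).2.
apply: IH => //; exists b' => // i; split=> //.
by case: i => [|i] //; exact: (bP i).2.
Qed.

(** * From a missing chain to a Lyapunov function *)

Lemma strict_lyapunov_of_not_eps_chain (R : realType) (M : metricType R)
    (g : homeo M) (e : R) (x : M) :
  0 < e -> ~ eps_chain g e x x -> exists u : M -> R, strict_lyapunov g u.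
Proof.
move=> e0 nxx; pose U := [set y | eps_chain g e x y].
have gclU y : closure U y -> nbhs (g y) U.
  move=> Uy; have e20 : 0 < e / 2 by rewrite divr_gt0.
  have [d d0 dP] := continuous_mdist (@homeo_fun_continuous _ g y) e20.
  have [|z [xz yz]] := Uy [set z | mdist y z < d].
    by apply/nbhs_mdistP; exists d.
  apply/nbhs_mdistP; exists (e / 2) => // t yt.
  apply: (eps_chain_trans xz); apply: eps_chain_step.
  apply: le_lt_trans (metric_triangle _ (g y) _) _.
  by rewrite (splitr e) ltrD// metric_sym dP.
have oU : open U.
  rewrite openE => y /= xy; apply/nbhs_mdistP.
  have [d [d0 xP]] : exists d, 0 < d /\ forall t, mdist y t < d -> eps_chain g e x t.
    elim: xy => {y nxx U gclU} [z y zy|z y t zy yt [d [d0 dP]]].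
      exists (e - mdist (g z) y); split=> [|t yt]; first by rewrite subr_gt0.
      apply: eps_chain_step; apply: le_lt_trans (metric_triangle _ y _) _.
      by rewrite -ltrBrDl.
    by exists d; split=> // t' /dP; exact: eps_chain_cons.
  by exists d.
pose N := closure U.
have gNE : g @` N = homeo_inv g @^-1` N.
  apply/seteqP; split=> [_ [y Ny <-]|y Ny]; first by rewrite /= homeo_funK.
  by exists (homeo_inv g y) => //; rewrite homeo_invK.
have cgN : closed (g @` N).
  rewrite gNE; apply: closed_comp => [y _|]; first exact: homeo_inv_continuous.
  exact: closed_closure.
have [q Nq ngNq] : exists2 q, N q & ~ (g @` N) q.
  have [Nx|nNx] := pselect (N x).
    exists x => // -[y /gclU/nbhs_singleton + yx]; rewrite yx.
    exact: nxx.
  exists (g x); last by rewrite gNE /= homeo_funK.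
  by apply: subset_closure; apply: eps_chain_step; rewrite mdistxx.
(* Any function equal to 0 on [g (closure U)] and to 1 off [U] is Lyapunov, as
   [g (closure U)] is inside [U]; the value 1 at [q] makes it strict. *)
have [|u [cu u01 u0 u1]] := (@uniform_separatorP M R (g @` N) (~` U `|` [set q])).1.
  apply: (@normal_separatorP R M).1 => //; first exact: pseudometric_normal.
    apply: closedU; first exact: open_closedC.
    by apply: accessible_closed_set1; apply: hausdorff_accessible; exact: metric_hausdorff.
  rewrite -subset0 => y [gNy [nUy|yq]]; last by apply: ngNq; rewrite -yq.
  by case: gNy nUy => t /gclU/nbhs_singleton Ut <-; apply.
exists u; split; first split=> // y.
  have /(_ _ (imageT u _)) u01' := u01.
  have := u01' y; have := u01' (g y); rewrite /= !in_itv/=.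
  move=> /andP[g0 g1] /andP[y0 y1].
  have [Ny|nNy] := pselect (N y).
    by have -> : u (g y) = 0 by apply: u0; exists (g y) => //; exists y.
  have -> // : u y = 1.
  by apply: u1; exists y => //; left => Uy; apply: nNy; exact: subset_closure.
exists q.
have -> : u (g q) = 0 by apply: u0; exists (g q) => //; exists q.
have -> : u q = 1 by apply: u1; exists q => //; right.
exact: ltr01.
Qed.

(** * Absence of cycles excludes chain recurrence outside GR(f) *)

Lemma without_cycles_not_eps_chain (R : realType) (M : metricType R)
    (f : homeo M) (k : nat) (L : 'I_k -> set M) (x : M) :
  compact [set: M] -> decomposition f L -> without_cycles f L ->
  ~ generalized_recurrent R f x -> exists2 e : R, 0 < e & ~ eps_chain f e x x.
Proof.
move=> cM [cL fL tL GRE] nocycle nGRx; apply: contrapT => noe.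
have xx e : 0 < e -> eps_chain f e x x.
  by move=> e0; apply: contrapT => nxx; apply: noe; exists e.
pose K := [set y | forall e : R, 0 < e -> eps_chain f e x y /\ eps_chain f e y x].
have K_lim y : (forall e : R, 0 < e -> exists2 y', mdist y y' < e &
    eps_chain f e x y' /\ eps_chain f e y' x) -> K y.
  move=> yP e e0; have e20 : 0 < e / 2 by rewrite divr_gt0.
  have [d d0 dP] := continuous_mdist (@homeo_fun_continuous _ f y) e20.
  have [|y' yy' [xy' y'x]] := yP (Num.min d (e / 2)); first by rewrite lt_min d0.
  have le2 : Num.min d (e / 2) <= e / 2 by rewrite ge_min lexx orbT.
  move: yy'; rewrite lt_min => /andP[yd ye].
  rewrite (splitr e); split.
    by apply: eps_chain_last (eps_chain_le le2 xy') _; rewrite metric_sym.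
  by apply: eps_chain_head (eps_chain_le le2 y'x) _; exact: dP.
have Kf y : K y -> K (f y).
  move=> Ky e e0; have e20 : 0 < e / 2 by rewrite divr_gt0.
  split.
    by apply: eps_chain_trans (Ky _ e0).1 _; apply: eps_chain_step; rewrite mdistxx.
  have [d d0 dP] := continuous_mdist (@homeo_fun_continuous _ f (f y)) e20.
  have m0 : 0 < Num.min d (e / 2) by rewrite lt_min d0.
  have le2 : Num.min d (e / 2) <= e / 2 by rewrite ge_min lexx orbT.
  (* The first jump from [y] lands at some [z] near [f y], and the rest of the chain can be
     restarted from [f y]. If there was only one jump, then [z] is [x] and a chain from [x] to
     itself serves as the rest. *)
  have [z yz zx] : exists2 z, mdist (f y) z < d & eps_chain f (e / 2) z x.
    suff chain_tail a c : eps_chain f (Num.min d (e / 2)) a c -> c = x ->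
        exists2 z, mdist (f a) z < d & eps_chain f (e / 2) z x.
      exact: chain_tail (Ky _ m0).2 erefl.
    case=> {a c} [a c + cx|a b c + bc cx]; rewrite lt_min => /andP[ad _].
      by exists x; [rewrite -cx|exact: xx].
    by exists b => //; rewrite -cx; exact: eps_chain_le bc.
  by rewrite (splitr e); apply: eps_chain_head zx _; exact: dP.
have K_iter y m : K y -> K (iter m f y) by move=> Ky; elim: m => //= m; exact: Kf.
have gLK i y : L i y -> L i (homeo_inv f y).
  by rewrite -{1}(fL i) => -[z Lz <-]; rewrite homeo_funK.
have LE i j y : L i y -> L j y -> i = j.
  by move=> Li Lj; apply: (tL i j) => //; exists y.
have clL i : closed (L i) by apply: compact_closed => //; exact: metric_hausdorff.
(* With the other components gathered into one closed invariant set, [orbit_limit] applies to the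
   pair [L i], [L' i]. *)
pose L' i := \bigcup_(j in [set j | j != i]) L j.
have clL' i : closed (L' i).
  by apply: closed_bigcup => [|j _]; [exact: finite_finset|exact: clL].
have LL' i : L i `&` L' i = set0.
  by rewrite -subset0 => y [Li [j /= ji Lj]]; rewrite (LE _ _ _ Li Lj) eqxx in ji.
have GR_L i y : generalized_recurrent R f y -> (L i `|` L' i) y.
  rewrite GRE => -[j _ Lj]; have [<-|ji] := eqVneq j i; first by left.
  by right; exists j.
have fLs i : f @` L i `<=` L i by rewrite fL.
have gLs i : homeo_inv f @` L i `<=` L i by move=> _ [y Ly <-]; exact: gLK.
have fL's i : f @` L' i `<=` L' i.
  by move=> _ [y [j ji Lj] <-]; exists j => //; apply: fLs; exists y.
have gL's i : homeo_inv f @` L' i `<=` L' i.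
  by move=> _ [y [j ji Lj] <-]; exists j => //; apply: gLs; exists y.
(* The components meeting [K]: each of them is left by a connecting orbit lying
   in [K], which lands in another such component, whence a cycle. *)
pose P i := `[< exists2 p, L i p & K p >].
have landing y : K y -> exists2 j, P j & stable_set f (L j) y.
  move=> Ky; have [p [_ yp]] := cM (iter k f y @[k --> \oo]) _ filterT.
  have := orbit_cluster_generalized_recurrent yp; rewrite GRE => -[j _ Lj].
  exists j.
    apply/asboolP; exists p => //; apply: K_lim => e e0.
    have [|m _ pm] := (cluster_seqP _ _).1 yp [set z | mdist p z < e] 0%N.
      by apply/nbhs_mdistP; exists e.
    by exists (iter m f y) => //; exact: K_iter.
  apply: set_dist_cvg0 => //; apply: (orbit_limit cM _ (clL j) (clL' j)) => //.
  - exact: homeo_fun_continuous.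
  - by move=> q /orbit_cluster_generalized_recurrent; exact: GR_L.
  - by exists p.
have leaving i : P i -> exists2 y, K y &
    ~ generalized_recurrent R f y /\ unstable_set f (L i) y.
  move=> /asboolP[a La Ka].
  have nLx j : ~ L j x by move=> Lx; apply: nGRx; rewrite GRE; exists j.
  (* Adding [x] to the set separated from [L i] keeps [x] outside [V], which forces chains to [x] to
     exit [V]. *)
  have clLx : closed (L' i `|` [set x]).
    apply: closedU => //.
    by apply: accessible_closed_set1; apply: hausdorff_accessible; exact: metric_hausdorff.
  have [|V [V' [oV oV' LV LV' VV']]] :=
    (@normal_openP R M).1 pseudometric_normal (L i) (L' i `|` [set x]) (clL i) clLx.
    rewrite -subset0 => y [Li [L'y|yx]]; last by apply: (nLx i); rewrite -yx.
    by rewrite -(LL' i).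
  have clV y : closure V y -> ~ V' y.
    move=> Vy V'y; have /Vy [z] : nbhs y V' by apply: open_nbhs_nbhs.
    by rewrite VV' => -[].
  have nVx : ~ V x by move=> /subset_closure/clV; apply; apply: LV'; right.
  (* A chain from [a] to [x] exits [V]; as its size tends to 0, the exit points
     accumulate at some [y] whose strict backward orbit stays in [closure V]. *)
  pose Q (e : R) := [set y | exists b : nat -> M, [/\ b 0%N = y, ~ V y,
    forall i, mdist (f (b i.+1)) (b i) < e /\ V (b i.+1),
    eps_chain f e x y & eps_chain f e y x]].
  have [|e e0|y yP] := @approx_cluster _ _ Q cM.
  - move=> d e de y [b [b0 nVy bP xy yx]]; exists b; split => //.
    + by move=> j; have [bj Vj] := bP j; split => //; exact: lt_le_trans de.
    + exact: eps_chain_le xy.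
    + exact: eps_chain_le yx.
  - have [xa ax] := Ka e e0.
    have [|b [nVb bP xb bx]] := eps_chain_exit nVx (xx e e0) ax xa.
      (* The exact backward orbit of [a] stays in [L i], hence in [V], and extends the chain
         infinitely into the past. *)
      exists (fun j => iter j (homeo_inv f) a) => // j; split.
        by rewrite iterS homeo_invK mdistxx.
      by apply: LV; elim: j => //= j; exact: gLK.
    by exists (b 0%N), b.
  have nVy : ~ V y.
    move=> Vy; have /nbhs_mdistP[e e0 eV] : nbhs y V by apply: open_nbhs_nbhs.
    by have [z /eV Vz [b []]] := yP e e0.
  (* The index starts at 1 because [y], a limit of exit points, is itself outside [V]. *)
  have clVy j : closure V (iter j.+1 (homeo_inv f) y).
    move=> B /backward_shadowing[d d0 dW].
    have [z yz [b [b0 _ bP _ _]]] := yP d d0.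
    exists (b j.+1); split; first exact: (bP j).2.
    by apply: dW => [m|]; [exact: (bP m).1|rewrite b0].
  have Ky : K y by apply: K_lim => e e0; have [z yz [b []]] := yP e e0; exists z.
  have nL' z : closure V z -> ~ L' i z.
    by move=> /clV nV' L'z; apply: nV'; apply: LV'; left.
  exists y => //; split.
    move=> /(GR_L i)[/LV //|L'y].
    by apply: (nL' _ (clVy 0%N)); apply: gL's; exists y.
  (* Backward limit points of [y] are in GR(f) and in [closure V], which misses every component but
     [L i]. *)
  have clus p : cluster (iter k (homeo_inv f) y @[k --> \oo]) p -> L i p.
    move=> yp; have := backward_orbit_cluster_generalized_recurrent yp.
    move=> /(GR_L i)[//|/nL' []]; move=> B Bp.
    have [[//|m] _ Bm] := (cluster_seqP _ _).1 yp _ 1%N (nbhs_interior Bp).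
    exact: clVy Bm.
  exact: set_dist_cvg0.
(* The point [x] itself lies in [K], so its forward limit gives a first component meeting [K]. *)
have [i0 Pi0 _] := landing x (fun e e0 => conj (xx e e0) (xx e e0)).
have [|c c0] := @cycle_of_successors _ P
    (fun i j => `[< connects f (L i) (L j) >]) i0 Pi0.
  move=> i /leaving[y Ky [nGRy uy]]; have [j Pj sy] := landing y Ky.
  by exists j => //; apply/asboolP; exists y.
by apply/negP; exact: nocycle.
Qed.

(** * Uniform distance and conclusion *)

Lemma mdist_le_dC0 (R : realType) (M : metricType R) (f g : homeo M) (x : M) :
  compact [set: M] -> mdist (f x) (g x) <= dC0 f g.
Proof.
move=> /compact_near_coveringP cM; apply: ub_le_sup; last by exists x.
(* The supremum bounds its set only if that set is bounded above; compactness, applied with the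
   filter at infinity, bounds all distances from [x]. *)
have [|D [_ DM]] := cM _ (pinfty_nbhs R) (fun r y => mdist x y <= r) _.
  move=> y _; exists ([set z | mdist y z < 1], [set r | mdist x y + 1 < r]).
    split; first by apply/nbhs_mdistP; exists 1.
    by exists (mdist x y + 1); split => //; exact: num_real.
  move=> [z r] /= [yz yr]; apply: le_trans (ltW yr).
  by apply: le_trans (metric_triangle _ y _) _; rewrite lerD2l ltW.
have {}DM y : mdist x y <= D + 1 by apply: DM => //; rewrite ltrDl.
exists (D + 1 + (D + 1)) => _ [y _ <-].
by apply: le_trans (metric_triangle _ x _) _; rewrite lerD// metric_sym.
Qed.

Theorem proposition5p2 (R : realType) (n : nat) (M : metricType R)
    (hn : (2 <= n)%N)
    (hM : topological_manifold R n M)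
    (hcompact : compact [set: M])
    (f : homeo M)
    (hf : exists u : M -> R, strict_lyapunov f u)
    (hdec : exists (k : nat) (L : 'I_k -> set M),
        decomposition f L /\ without_cycles f L) :
  exists V : set (homeo M),
    homeo_nbhs f V /\
    forall g : homeo M, V g -> exists u : M -> R, strict_lyapunov g u.
Proof.
have [u [uf [x ux]]] := hf; have [k [L [dL nL]]] := hdec.
have [e e0 nxx] := without_cycles_not_eps_chain hcompact dL nL
  (strict_lyapunov_not_generalized_recurrent uf ux).
have e20 : 0 < e / 2 by rewrite divr_gt0.
exists [set g | dC0 f g < e / 2]; split; first by exists (e / 2).
move=> g fg; apply: (strict_lyapunov_of_not_eps_chain e20 (x := x)).
apply: contra_not nxx; apply: eps_chain_sub => y z gyz.
apply: le_lt_trans (metric_triangle _ (g y) _) _.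
rewrite (splitr e) ltrD//; apply: le_lt_trans fg.
exact: mdist_le_dC0.
Qed.
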